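(* Let $n$ be a positive integer and let $v_0$ be a vertex not in $K_n$. Let $H$ be a simple graph formed from the disjoint union $K_n\cup\{v_0\}$ by joining some of the vertices of $K_n$ to $v_0$. Let $R$ be the set of vertices of $H$ adjacent to $v_0$, let $S=V(H)\setminus(R\cup\{v_0\})$ be the set of vertices other than $v_0$ that are not adjacent to $v_0$, and put $r=|R|$, $s=|S|$ (so $r+s=n$). Let $G$ be a simple graph. Then $G$ is isomorphic to $H$ if and only if $$\begin{aligned}da(G;x,y)=\ &(1+xy^{2})\,da(K_{r};x,y) + y\, da(K_{s};x,y) + y\, da(K_{r};x,y)\,da(K_{s};x,y)\\ &+ xy^{n+1-r} + xy\, da(K_{r};x,y)\sum_{j=1}^{s}\binom{s}{j}x^{j}y^{\min\{2j,\,s+1\}}.\end{aligned}$$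
   Context: All graphs are finite and simple. For a graph $G$, $S\subseteq V(G)$ and $u\in V(G)$, let $\bar S=V(G)\setminus S$, let $\delta_S(u)=|\{v\in S:\{u,v\}\in E(G)\}|$, and let $G[S]$ be the subgraph induced by $S$. The defensive alliance polynomial of $G$ is $$da(G;x,y)=\sum_{S} x^{|S|}\,y^{f_y(S)},\qquad f_y(S)=\min_{u\in S}\bigl(\delta_S(u)-\delta_{\bar S}(u)+|V(G)|\bigr),$$ where the sum runs over all non-empty $S\subseteq V(G)$ such that $G[S]$ is connected (single-vertex graphs are connected). $K_m$ is the complete graph on $m$ vertices; for $m=0$ the sum is empty, so $da(K_0;x,y)=0$. *)

(* Defs.v *)
From HB Require Import structures.
From mathcomp Require Import all_boot all_order all_algebra.
From mathcomp Require Import mpoly.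

Set Implicit Arguments.
Unset Strict Implicit.
Unset Printing Implicit Defensive.

Import GRing.Theory.
Local Open Scope ring_scope.

Record sgraph := SGraph {
  vertex :> finType;
  adj : rel vertex;
  adj_sym : ssrbool.symmetric adj;
  adj_irr : irreflexive adj }.

Definition graph_iso (G H : sgraph) : Prop :=
  exists2 f : G -> H, bijective f & forall u v, adj (f u) (f v) = adj u v.

Section Induced.
Variables (G : sgraph) (S : {set G}).

Definition induced_vertex : finType := {u : G | u \in S}.
Definition induced_adj : rel induced_vertex := fun u v => adj (val u) (val v).

Lemma induced_adj_sym : ssrbool.symmetric induced_adj.
Proof. by move=> u v; exact: adj_sym. Qed.

Lemma induced_adj_irr : irreflexive induced_adj.
Proof. by move=> u; exact: adj_irr. Qed.

Definition induced : sgraph := SGraph induced_adj_sym induced_adj_irr.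

End Induced.

(* Any two vertices are joined by a path; the graph without vertices satisfies
   this vacuously, so non-emptiness is required separately where it matters. *)
Definition connected_graph (G : sgraph) : bool :=
  [forall u : G, forall v : G, connect (@adj G) u v].

Section Alliance.
Variable G : sgraph.

Definition delta (S : {set G}) (u : G) : nat := #|[set v in S | adj u v]|.

(* Adding #|G| first makes the subtraction on nat exact, as
   delta (~: S) u <= #|G|. *)
Definition alliance_val (S : {set G}) (u : G) : nat :=
  (delta S u + #|G| - delta (~: S) u)%N.

(* 2 * #|G| bounds every alliance_val S u from above, so that for a non-empty S
   this is the minimum of alliance_val S u over u in S (see fyP below). *)
Definition fy (S : {set G}) : nat :=
  \big[minn/(#|G|.*2)%N]_(u in S) alliance_val S u.

Lemma alliance_valE (S : {set G}) (u : G) :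
  (alliance_val S u)%:Z = (delta S u)%:Z - (delta (~: S) u)%:Z + #|G|%:Z.
Proof.
have le_d : (delta (~: S) u <= delta S u + #|G|)%N.
  by apply: leq_trans (leq_addl _ _); exact: max_card.
by rewrite /alliance_val -subzn // PoszD addrAC.
Qed.

Lemma fyP (S : {set G}) : S != set0 ->
  (exists2 u, u \in S & fy S = alliance_val S u) /\
  (forall u, u \in S -> (fy S <= alliance_val S u)%N).
Proof.
have le_fy u : u \in S -> (fy S <= alliance_val S u)%N.
  move=> uS; rewrite /fy -big_filter; have: u \in [seq i <- index_enum G | i \in S].
    by rewrite mem_filter uS mem_index_enum.
  elim: [seq _ <- _ | _] => //= a e IHe.
  rewrite inE big_cons => /predU1P[->|/IHe]; first exact: geq_minl.
  exact: leq_trans (geq_minr _ _).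
case/set0Pn=> u0 u0S; split=> //.
have [[u uS ->]|fyE] : (exists2 u, u \in S & fy S = alliance_val S u)
    \/ fy S = (#|G|.*2)%N.
- rewrite /fy; elim/big_ind: _ => [|a b Ha Hb|u uS]; [by right| |by left; exists u].
  by rewrite /minn; case: ifP.
- by exists u.
exists u0 => //; apply/eqP; rewrite eqn_leq le_fy //= fyE.
rewrite -addnn; apply: leq_trans (leq_subr _ _) _.
by rewrite leq_add2r; exact: max_card.
Qed.

End Alliance.

Definition varx : {mpoly int[2]} := 'X_0.
Definition vary : {mpoly int[2]} := 'X_1.

Definition da (G : sgraph) : {mpoly int[2]} :=
  \sum_(S : {set G} | (S != set0) && connected_graph (induced S))
    varx ^+ #|S| * vary ^+ fy S.

Section Complete.
Variable m : nat.

Definition complete_adj : rel 'I_m := fun i j => i != j.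

Lemma complete_adj_sym : ssrbool.symmetric complete_adj.
Proof. by move=> i j; rewrite /complete_adj eq_sym. Qed.

Lemma complete_adj_irr : irreflexive complete_adj.
Proof. by move=> i; rewrite /complete_adj eqxx. Qed.

Definition complete : sgraph := SGraph complete_adj_sym complete_adj_irr.

End Complete.

(* K_n together with a new vertex None, joined to the vertices in A. *)
Section CompletePlus.
Variables (n : nat) (A : {set complete n}).

Definition complete_plus_adj : rel (option (complete n)) := fun u v =>
  match u, v with
  | Some i, Some j => adj i j
  | Some i, None | None, Some i => i \in A
  | None, None => false
  end.

Lemma complete_plus_adj_sym : ssrbool.symmetric complete_plus_adj.
Proof. by case=> [i|] [j|] //; exact: complete_adj_sym. Qed.

Lemma complete_plus_adj_irr : irreflexive complete_plus_adj.
Proof. by case=> [i|] //; exact: complete_adj_irr. Qed.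

Definition complete_plus : sgraph :=
  SGraph complete_plus_adj_sym complete_plus_adj_irr.

End CompletePlus.

(* Main.v *)
(** Write codeg u = |G| - deg u.  Then alliance_val S u = 2 delta S u + codeg u,
    and every vertex of K_n has codegree 1 or 2, so the term of a
    connected set of H depends only on whether v0 belongs to it and on its
    numbers of vertices in R and in S.  Summing over these numbers gives the
    right-hand side, which is therefore da H.  Conversely, the coefficient of
    x y^k in da G counts the vertices of codegree k, so da G = da H yields a
    bijection H -> G preserving codegrees.  Such a bijection is an isomorphism:
    in the complement, H is a star with isolated vertices added, and the
    codegrees force the same star in G. *)
Require Import Defs.
From HB Require Import structures.
From mathcomp Require Import all_boot all_order all_algebra all_fingroup.
From mathcomp Require Import mpoly.
From mathcomp Require Import zify ring.

Set Implicit Arguments.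
Unset Strict Implicit.
Unset Printing Implicit Defensive.

Import GRing.Theory.
Local Open Scope ring_scope.

(** * Codegrees, alliance values and connectivity of induced subgraphs *)

Definition codeg (G : sgraph) (u : G) : nat := (#|G| - delta [set: G] u)%N.

Section Graph.
Variable G : sgraph.
Implicit Types (S : {set G}) (u v : G).

Lemma card_nonadj u : #|[set v | ~~ adj u v]| = codeg u.
Proof.
rewrite /codeg /delta -(cardsC [set v | adj u v]).
have -> : [set v in [set: G] | adj u v] = [set v | adj u v].
  by apply/setP=> v; rewrite !inE.
by rewrite addKn; apply: eq_card => v; rewrite !inE.
Qed.

(** The degree of [u] splits as [delta S u + delta (~: S) u], so subtracting the outside degree from
    [#|G|] leaves [codeg u + delta S u]. *)
Lemma alliance_val_codeg S u :
  alliance_val S u = ((delta S u).*2 + codeg u)%N.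
Proof.
rewrite /codeg; have -> : delta [set: G] u = (delta S u + delta (~: S) u)%N.
  rewrite /delta -[LHS](cardsID S); congr (_ + _)%N;
    by apply: eq_card => v; rewrite !inE // andbC.
have : (delta S u + delta (~: S) u <= #|G|)%N.
  rewrite /delta -(cardsC S); apply: leq_add; apply: subset_leq_card;
    by apply/subsetP => v; rewrite !inE => /andP[].
rewrite /alliance_val; lia.
Qed.

Lemma fy_min S u m : u \in S -> alliance_val S u = m ->
  (forall v, v \in S -> (m <= alliance_val S v)%N) -> fy S = m.
Proof.
move=> uS <- le_m; have S0 : S != set0 by apply/set0Pn; exists u.
have [[w wS fyE] fy_le] := fyP S0.
by apply/eqP; rewrite eqn_leq fy_le //= fyE le_m.
Qed.

Lemma fy_set1 u : fy [set u] = codeg u.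
Proof.
have E : alliance_val [set u] u = codeg u.
  rewrite alliance_val_codeg /delta (_ : [set v in _ | _] = set0) ?cards0 //.
  by apply/setP=> v; rewrite !inE; case: eqP => // ->; rewrite adj_irr.
by apply: (fy_min (set11 u) E) => v; rewrite inE => /eqP->; rewrite E.
Qed.

(** Any two vertices are joined through the hub [u]. In complete graphs and in [H], connectivity of
    a set is always obtained from such a hub. *)
Lemma connected_hub S u : u \in S ->
  (forall v, v \in S -> v != u -> adj u v) -> connected_graph (induced S).
Proof.
move=> uS hub; pose h : induced S := Sub u uS.
have hC (v : induced S) : connect (@adj (induced S)) h v.
  have [->|vh] := eqVneq v h; first exact: connect0.
  by apply: connect1; apply: hub => //; exact: valP.
apply/forallP=> v; apply/forallP=> w; apply: connect_trans (hC w).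
by rewrite (sym_connect_sym (@adj_sym _)).
Qed.

Lemma connected_set1 u : connected_graph (induced [set u]).
Proof.
by apply: (@connected_hub _ u) => [|v]; rewrite inE // => /eqP->; rewrite eqxx.
Qed.

Lemma isolated_disconnected S u v : u \in S -> v \in S -> v != u ->
  (forall w, w \in S -> ~~ adj u w) -> connected_graph (induced S) = false.
Proof.
move=> uS vS vu iso; apply/negP => /forallP/(_ (Sub u uS))/forallP/(_ (Sub v vS)).
case/connectP => -[|w p] /=.
  by move=> _ /(congr1 val) /= E; rewrite E eqxx in vu.
by case/andP => uw; have /negP[] := iso _ (valP w).
Qed.

End Graph.

(** * Invariance of [da] under isomorphism *)

(** Paths are carried to paths. [da_iso] applies this both to [f] and to its inverse. *)
Lemma connected_imset (G H : sgraph) (f : G -> H) (S : {set G}) :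
  {homo f : u v / adj u v} ->
  connected_graph (induced S) -> connected_graph (induced (f @: S)).
Proof.
move=> hom conn; pose F (u : induced S) : induced (f @: S) :=
  Sub (f (val u)) (imset_f f (valP u)).
have Fsurj (v : induced (f @: S)) : exists u, v = F u.
  case/imsetP: (valP v) => u uS fu; exists (Sub u uS); exact: val_inj.
apply/forallP=> u; apply/forallP=> v.
have [[u' ->] [v' ->]] := (Fsurj u, Fsurj v).
have /connectP[p up ->] := forallP (forallP conn u') v'.
apply/connectP; exists (map F p); last by rewrite last_map.
by apply: homo_path up => a b; exact: hom.
Qed.

Section Iso.
Variables (G H : sgraph) (f : G -> H).
Hypotheses (f_bij : bijective f) (f_adj : forall u v, adj (f u) (f v) = adj u v).

Lemma delta_iso (S : {set G}) u : delta (f @: S) (f u) = delta S u.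
Proof.
have f_inj := bij_inj f_bij.
rewrite /delta -(card_imset _ f_inj); apply: eq_card => v; rewrite inE.
apply/andP/imsetP=> [[/imsetP[w wS ->]]|[w]]; rewrite ?f_adj.
  by move=> uw; exists w; rewrite ?inE ?wS.
by rewrite inE => /andP[wS uw] ->; rewrite f_adj mem_imset.
Qed.

Lemma fy_iso (S : {set G}) : S != set0 -> fy (f @: S) = fy S.
Proof.
have fT : f @: [set: G] = [set: H].
  have [g _ gK] := f_bij; apply/setP=> v.
  by rewrite inE -(gK v) imset_f.
have valE u : alliance_val (f @: S) (f u) = alliance_val S u.
  by rewrite !alliance_val_codeg /codeg -(bij_eq_card f_bij) -fT !delta_iso.
case/fyP=> [[u uS fyE] fy_le]; apply: (fy_min (u := f u)); rewrite ?imset_f ?valE //.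
by move=> _ /imsetP[w wS ->]; rewrite valE fy_le.
Qed.

Lemma da_iso : da H = da G.
Proof.
have [g fK gK] := f_bij.
have fgS (S : {set H}) : f @: (g @: S) = S.
  by rewrite -imset_comp (eq_imset _ (gK : f \o g =1 id)) imset_id.
have gfS (S : {set G}) : g @: (f @: S) = S.
  by rewrite -imset_comp (eq_imset _ (fK : g \o f =1 id)) imset_id.
rewrite /da (reindex (fun S : {set G} => f @: S)) /=; last first.
  by exists (fun S : {set H} => g @: S) => S _; [exact: gfS | exact: fgS].
apply: eq_big => [S|S /andP[S0 _]]; last first.
  rewrite fy_iso ?card_imset //; first exact: bij_inj f_bij.
  by rewrite imset_eq0 in S0.
rewrite imset_eq0; congr (_ && _); apply/idP/idP; last first.
  by apply: connected_imset => u v; rewrite f_adj.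
rewrite -[in X in _ -> X](gfS S); apply: connected_imset => u v.
by rewrite -f_adj !gK.
Qed.

End Iso.

(** * Codegree counts as coefficients of [da] *)

Lemma mcoeff_varxy (a b c d : nat) :
  (varx ^+ a * vary ^+ b)@_[multinom (if i == ord0 then c else d) | i < 2]
    = ((a == c) && (b == d))%:R.
Proof.
rewrite /varx /vary !mpolyXn -mpolyXD mcoeffX; congr (nat_of_bool _)%:R.
apply/eqP/andP=> [/mnmP E|[/eqP-> /eqP->]].
  have := E ord0; have := E (lift ord0 ord0).
  rewrite !mnmDE !mulmnE !mnm1E !mnmE /= !mul1n !mul0n add0n addn0 => -> ->.
  by rewrite !eqxx.
apply/mnmP=> i; rewrite mnmDE !mulmnE !mnm1E mnmE.
by case: i => -[|[|//]] ? /=; rewrite !mul1n !mul0n ?add0n ?addn0.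
Qed.

(** Only singletons have degree one in [x]; they are connected, and [fy_set1] identifies their
    [y]-exponent with a codegree. *)
Lemma mcoeff_da (G : sgraph) (k : nat) :
  (da G)@_[multinom (if i == ord0 then 1 else k)%N | i < 2]
    = #|[set u : G | codeg u == k]|%:R.
Proof.
rewrite /da raddf_sum /= (eq_bigr _ (fun S _ => mcoeff_varxy _ _ _ _)).
rewrite -natr_sum; congr _%:R.
rewrite -big_mkcondr /= sum1_card -(card_imset _ (@set1_inj G)).
apply: eq_card => S; rewrite unfold_in.
apply/andP/imsetP=> [[_ /andP[/cards1P[u ->] fyk]]|[u + ->]].
  by exists u; rewrite // inE -fy_set1.
by rewrite inE fy_set1 connected_set1 -cards_eq0 cards1.
Qed.

(** Equal counts make the value lists [codom f1] and [codom f2] permutations of each other. *)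
Lemma bij_of_count (T1 T2 : finType) (f1 : T1 -> nat) (f2 : T2 -> nat) :
  (forall k, #|[set u | f1 u == k]| = #|[set u | f2 u == k]|) ->
  exists2 g : T1 -> T2, bijective g & forall u, f2 (g u) = f1 u.
Proof.
move=> cnt.
have countE (T : finType) (f : T -> nat) k :
    count_mem k (codom f) = #|[set u | f u == k]|.
  rewrite codomE count_map enumT cardE /enum_mem size_filter.
  by apply: eq_count => u; rewrite /= inE.
have pm : perm_eq (codom f1) (codom f2).
  by apply/allP=> k _ /=; rewrite !countE cnt.
have cT : #|T1| = #|T2| by move/perm_size: pm; rewrite !size_codom.
have /tuple_permP[p codE] : perm_eq (codom f1) (codom_tuple f2) by [].
(* With [p] matching the two value lists, [g] sends the element of rank [i] in [T1] to the element
   of rank [p i] in [T2]. *)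
pose g u := enum_val (p (cast_ord cT (enum_rank u))).
exists g; first by apply: inj_card_bij; rewrite ?cT // => u v /enum_val_inj
  /perm_inj /cast_ord_inj /enum_rank_inj.
move=> u; set j := cast_ord cT (enum_rank u).
have := congr1 (nth 0%N ^~ (enum_rank u)) codE.
rewrite codomE (nth_map u) ?nth_enum_rank => [->|]; last by rewrite -cardE.
rewrite -[nat_of_ord (enum_rank u)]/(nat_of_ord j).
rewrite -(tnth_nth _ [tuple _ | i < _]) tnth_mktuple.
rewrite (tnth_nth 0%N) /= codomE (nth_map (g u)); last by rewrite -cardE.
by congr f2; exact: enum_val_nth.
Qed.

(** * Recovering the graph from its polynomial *)

Section Converse.
Variables (n : nat) (A : {set complete n}).
Let H := complete_plus A.

Lemma card_complete_plus : #|H| = n.+1.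
Proof. by rewrite card_option card_ord. Qed.

Lemma codeg_None : @codeg H None = (#|~: A|).+1.
Proof.
rewrite -card_nonadj (cardsD1 None) inE /= add1n; congr _.+1.
rewrite -[in RHS](card_imset _ Some_inj); apply: eq_card => u.
rewrite !inE; apply/andP/imsetP=> [|[i + ->]]; last by rewrite inE.
by case: u => [i|] [] // _ iA; exists i; rewrite ?inE.
Qed.

(** Besides [Some i] itself, the only possible non-neighbour is [None]. *)
Lemma codeg_Some i : @codeg H (Some i) = (i \notin A).+1.
Proof.
rewrite -card_nonadj (cardsD1 (Some i)) inE adj_irr add1n; congr _.+1.
rewrite (cardsD1 None) !inE /= (_ : _ :\ None = set0) ?cards0 ?addn0 //.
apply/setP=> -[j|]; rewrite !inE ?eqxx //=.
by rewrite (inj_eq Some_inj) negbK eq_sym andNb.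
Qed.

(* R maps to vertices adjacent to all others, so the non-neighbours of g v0 lie
   in g S, and they fill it as codeg v0 = |S| + 1; a vertex of g S, having
   codegree 2, then has g v0 as its only non-neighbour. *)
Lemma codeg_bij_iso (G : sgraph) (g : H -> G) :
  bijective g -> (forall u, codeg (g u) = codeg u) ->
  forall u v, adj (g u) (g v) = adj u v.
Proof.
move=> g_bij gE; have g_inj := bij_inj g_bij.
(* Known non-neighbours of [u], once as numerous as the codegree, are all of them; this turns
   counting into adjacency. *)
have nonadj_sub (u : G) (N : {set G}) :
    #|N| = codeg u -> N \subset [set v | ~~ adj u v] ->
    forall v, adj u v = (v \notin N).
  move=> cN sN v; have /eqP-> : N == [set v | ~~ adj u v].
    by rewrite eqEcard sN card_nonadj cN leqnn.
  by rewrite inE negbK.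
have adjA i v : i \in A -> adj (g (Some i)) v = (v != g (Some i)).
  move=> iA; rewrite (@nonadj_sub _ [set g (Some i)]) ?inE //.
    by rewrite cards1 gE codeg_Some iA.
  by rewrite sub1set inE adj_irr.
have g_onto v : exists u, v = g u.
  by have [h _ hK] := g_bij; exists (h v); rewrite hK.
have adjN v : adj (g None) v = (v \notin g None |: [set g (Some i) | i in ~: A]).
  have E : [set v | ~~ adj (g None) v] \subset
           g None |: [set g (Some i) | i in ~: A].
    apply/subsetP => w; have [[i|] ->] := g_onto w; rewrite !inE ?eqxx //.
    have [iA|iA _] := boolP (i \in A); last first.
      by rewrite imset_f ?orbT // inE.
    by rewrite adj_sym adjA // inj_eq.
  have /eqP <- : [set v | ~~ adj (g None) v] ==
           g None |: [set g (Some i) | i in ~: A].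
    rewrite eqEcard E card_nonadj gE codeg_None cardsU1 card_imset; last first.
      by move=> i j /g_inj[].
    by rewrite -add1n leq_add2r leq_b1.
  by rewrite inE negbK.
have adjNS i : adj (g None) (g (Some i)) = (i \in A).
  rewrite adjN !inE inj_eq //= mem_imset ?inE ?negbK //.
  by move=> j k /g_inj[].
have adjS i v : i \notin A ->
    adj (g (Some i)) v = (v \notin [set g (Some i); g None]).
  move=> iA; apply: nonadj_sub.
    by rewrite cards2 gE codeg_Some iA inj_eq.
  by apply/subsetP=> w; rewrite !inE => /orP[]/eqP->; rewrite ?adj_irr // adj_sym adjNS.
move=> [i|] [j|]; rewrite ?adj_irr //= ?adjNS //; last by rewrite adj_sym adjNS.
have [iA|iA] := boolP (i \in A); first by rewrite adjA // inj_eq // eq_sym.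
by rewrite adjS // !inE !(inj_eq g_inj) /= orbF (inj_eq Some_inj) eq_sym.
Qed.

Lemma iso_of_da (G : sgraph) : da G = da H -> graph_iso G H.
Proof.
move=> daE; have [|g g_bij gE] := @bij_of_count H G (@codeg H) (@codeg G).
  (* The coefficients of [x y^k] are the counts as integers, so the counts agree. *)
  move=> k; have := congr1 (mcoeff [multinom (if i == ord0 then 1 else k)%N | i < 2]) daE.
  by rewrite !mcoeff_da !natz => -[].
have g_adj := codeg_bij_iso g_bij gE; have [f gK fK] := g_bij.
by exists f => [|u v]; [exists g | rewrite -g_adj !fK].
Qed.

End Converse.

(** * Sums over subsets, grouped by cardinalities *)

Section BinomialSums.
Variables (T : finType) (V : nmodType).

Lemma sum_card_subset (A : {set T}) (f : nat -> V) :
  \sum_(B : {set T} | B \subset A) f #|B|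
    = \sum_(i < #|A|.+1) f i *+ 'C(#|A|, i).
Proof.
rewrite (partition_big (fun B : {set T} => inord #|B| : 'I_#|A|.+1) xpredT) //=.
apply: eq_bigr => i _; rewrite -cards_draws -sumr_const.
apply: congr_big => // [B|B /andP[BA /eqP<-]]; last first.
  by rewrite inordK // ltnS subset_leq_card.
rewrite inE; have [BA|] //= := boolP (B \subset A).
by rewrite -val_eqE /= inordK // ltnS subset_leq_card.
Qed.

(** [B] corresponds to the pair [(B :&: A, B :\: A)] of independent subsets of [A] and [~: A];
    [sum_card_subset] is then applied to each component. *)
Lemma sum_card_setID (A : {set T}) (F : nat -> nat -> V) :
  \sum_(B : {set T}) F #|B :&: A| #|B :\: A|
    = \sum_(i < #|A|.+1) \sum_(j < #|~: A|.+1)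
        F i j *+ ('C(#|A|, i) * 'C(#|~: A|, j)).
Proof.
pose F' i := \sum_(C : {set T} | C \subset ~: A) F i #|C|.
transitivity (\sum_(B : {set T} | B \subset A) F' #|B|); last first.
  rewrite sum_card_subset; apply: eq_bigr => i _.
  rewrite /F' (sum_card_subset (~: A) (F i)) -sumrMnl; apply: eq_bigr => j _.
  by rewrite -mulrnA mulnC.
rewrite /F' pair_big /=.
rewrite (reindex_onto (fun p : {set T} * {set T} => p.1 :|: p.2)
           (fun B => (B :&: A, B :\: A))) /=; last by move=> B _; rewrite setID.
have E (B C : {set T}) : B \subset A -> C \subset ~: A ->
    (B :|: C) :&: A = B /\ (B :|: C) :\: A = C.
  move=> BA CA; rewrite setIUl setDUl (setIidPl BA) [C :\: A]setDE (setIidPl CA).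
  have /eqP-> : B :\: A == set0 by rewrite setD_eq0.
  have /eqP-> : C :&: A == set0 by rewrite -[A]setCK -setDE setD_eq0.
  by rewrite setU0 set0U.
apply: eq_big => [[B C]|[B C] /eqP[EB EC]] /=; last by rewrite EB EC.
apply/eqP/andP=> [[<- <-]|[BA CA]]; last by have [-> ->] := E B C BA CA.
by rewrite subsetIr setDE subsetIr.
Qed.

End BinomialSums.

Definition binsum (R : pzRingType) (m : nat) (f : nat -> R) : R :=
  \sum_(i < m.+1) f i *+ 'C(m, i).

Lemma binsumZ (R : pzRingType) m (c : R) (f : nat -> R) :
  binsum m (fun i => c * f i) = c * binsum m f.
Proof. by rewrite /binsum mulr_sumr; apply: eq_bigr => i _; rewrite mulrnAr. Qed.

(** The indicator [(i == 0)] encodes that one of the two parts of a set is empty, a condition met by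
    exactly one subset of that part. *)
Lemma binsum_eq0 (R : pzRingType) m :
  binsum m (fun i => (i == 0%N)%:R : R) = 1.
Proof.
rewrite /binsum big_ord_recl bin0 mulr1n big1 ?addr0 // => i _.
by rewrite mul0rn.
Qed.

Lemma binsumM (R : pzRingType) m p (f g : nat -> R) :
  \sum_(i < m.+1) \sum_(j < p.+1) (f i * g j) *+ ('C(m, i) * 'C(p, j))
    = binsum m f * binsum p g.
Proof.
rewrite /binsum mulr_suml; apply: eq_bigr => i _; rewrite mulr_sumr.
by apply: eq_bigr => j _; rewrite mulrnAl mulrnAr mulrnA mulrnAC.
Qed.

Section OptionSets.
Variable T : finType.

(** The flag [b] tells whether [None] belongs to the set; each subset of [option T] arises from
    exactly one pair [(b, B)]. *)
Definition opt_set (b : bool) (B : {set T}) : {set option T} :=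
  [set u | if u is Some i then i \in B else b].

Lemma card_opt_set b B : #|opt_set b B| = (b + #|B|)%N.
Proof.
rewrite (cardsD1 None) inE; congr (_ + _)%N.
rewrite -[in RHS](card_imset _ Some_inj); apply: eq_card => -[i|]; rewrite !inE /=.
  by rewrite mem_imset //; exact: Some_inj.
by apply/esym/negP => /imsetP[].
Qed.

Lemma sum_opt_set (V : nmodType) (F : {set option T} -> V) :
  \sum_S F S = \sum_B (F (opt_set false B) + F (opt_set true B)).
Proof.
rewrite (reindex (fun p => opt_set p.1 p.2)) /=; last first.
  exists (fun S : {set option T} =>
            (None \in S, [set i | Some i \in S])) => [[b B]|S] _ /=.
    by rewrite inE; congr pair; apply/setP=> i; rewrite !inE.
  by apply/setP=> -[i|]; rewrite !inE.
rewrite -(pair_bigA _ (fun b B => F (opt_set b B))) /= big_bool /= addrC.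
by rewrite -big_split.
Qed.

End OptionSets.

(** * The polynomial of a complete graph *)

(** The contribution of a [k]-subset of a complete graph: each member has [k - 1] neighbours inside
    and codegree 1, hence the exponent [2k - 1]. The value 0 at [k = 0] discards the empty set. *)
Definition clique_term (k : nat) : {mpoly int[2]} :=
  if k is k'.+1 then varx ^+ k'.+1 * vary ^+ k'.*2.+1 else 0.

Lemma da_complete m : da (complete m) = binsum m clique_term.
Proof.
have -> : da (complete m) = \sum_(S : {set complete m}) clique_term #|S|.
  rewrite /da big_mkcond; apply: eq_bigr => S _.
  have [->|S0] /= := eqVneq S set0; first by rewrite cards0.
  have /set0Pn[u uS] := S0.
  rewrite (@connected_hub _ _ u) => [|//|v _]; last by rewrite eq_sym.
  have codeg1 v : @codeg (complete m) v = 1%N.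
    rewrite -card_nonadj -(cards1 v); apply: eq_card => w.
    by rewrite !inE /= /complete_adj negbK eq_sym.
  have valE v : v \in S -> alliance_val S v = #|S|.*2.-1.
    move=> vS; rewrite alliance_val_codeg codeg1 (cardsD1 v S) vS addn1 /delta.
    congr (_.*2.+1); apply: eq_card => w.
    by rewrite !inE /= /complete_adj eq_sym andbC.
  rewrite (fy_min uS (valE u uS)) => [|v vS]; last by rewrite valE.
  by rewrite (cardsD1 u) uS.
rewrite (eq_bigl (fun S : {set complete m} => S \subset [set: complete m])).
  by rewrite sum_card_subset cardsT card_ord.
by move=> S; rewrite subsetT.
Qed.

(** * The polynomial of [H] *)

Section DaCompletePlus.
Variables (n : nat) (A : {set complete n}).
Let H := complete_plus A.
Implicit Type B : {set complete n}.

Lemma alliance_val_None b B :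
  alliance_val (opt_set b B : {set H}) None = (#|B :&: A|.*2 + #|~: A|.+1)%N.
Proof.
rewrite alliance_val_codeg codeg_None; congr (_.*2 + _)%N.
rewrite -[RHS](card_opt_set false); apply: eq_card => -[i|]; rewrite !inE //=.
by rewrite andbF.
Qed.

Lemma alliance_val_Some b B i : i \in B ->
  alliance_val (opt_set b B : {set H}) (Some i)
    = (#|B|.*2 + (i \notin A) + (b && (i \in A)).*2).-1.
Proof.
move=> iB; rewrite alliance_val_codeg codeg_Some (cardsD1 i B) iB.
have -> : delta (opt_set b B : {set H}) (Some i) = ((b && (i \in A)) + #|B :\ i|)%N.
  rewrite -(card_opt_set _ (B :\ i)); apply: eq_card => -[j|]; rewrite !inE //=.
  by rewrite /complete_adj eq_sym andbC.
lia.
Qed.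

(** The three summands correspond to [B] inside [A], [B] disjoint from [A], and [B] meeting both
    sides; at most one is nonzero. Any nonempty [B] is a clique. *)
Lemma da_term_without_None B :
  (if ((opt_set false B : {set H}) != set0) &&
     connected_graph (induced (opt_set false B : {set H}))
   then varx ^+ #|opt_set false B| * vary ^+ fy (opt_set false B : {set H}) else 0)
  = let i := #|B :&: A| in let j := #|B :\: A| in
    clique_term i * (j == 0%N)%:R + (i == 0%N)%:R * (vary * clique_term j)
    + (vary * clique_term i) * clique_term j.
Proof.
rewrite -cards_eq0 !card_opt_set add0n /=.
have cB := cardsID A B.
have [B0|/set0Pn[u uB]] := eqVneq B set0.
  by rewrite B0 set0I set0D !cards0 /=; ring.
have -> : connected_graph (induced (opt_set false B : {set H})).
  apply: (@connected_hub H _ (Some u)) => [|[v|]]; rewrite !inE //= => _.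
  by rewrite (inj_eq Some_inj) eq_sym.
have B0 : #|B| != 0%N by rewrite cards_eq0; apply/set0Pn; exists u.
have le_v (v : H) : v \in opt_set false B ->
    ((#|B|.*2 + (#|B :&: A| == 0)).-1 <= alliance_val (opt_set false B : {set H}) v)%N.
  case: v => [v|]; rewrite inE // => vB; rewrite alliance_val_Some //=.
  have [vA|] := boolP (v \in A); last by lia.
  by rewrite (cardsD1 v (B :&: A)) inE vB vA /= !addn0 leqnn.
(* A vertex of [A] attains the minimum if [B] has one; otherwise all vertices of [B] have codegree 2
   and the value rises by one. *)
have -> : fy (opt_set false B : {set H}) = (#|B|.*2 + (#|B :&: A| == 0)).-1.
  have [E|/set0Pn[w]] := eqVneq (B :&: A) set0.
    apply: (@fy_min H _ (Some u)) le_v; first by rewrite inE.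
    rewrite alliance_val_Some //= E cards0.
    have: u \notin B :&: A by rewrite E inE.
    by rewrite inE uB /= => ->; rewrite addn0.
  rewrite inE => /andP[wB wA].
  apply: (@fy_min H _ (Some w)) le_v; first by rewrite inE.
  by rewrite alliance_val_Some //= wA (cardsD1 w (B :&: A)) inE wB wA /= !addn0.
rewrite B0; move: B0; rewrite -{}cB.
case: #|B :&: A| #|B :\: A| => [|i] [|j] //= _.
- by rewrite add0n addn1 !exprS; ring.
- by rewrite !addn0 !exprS; ring.
- by rewrite addn0 addSn doubleD doubleS addnS !exprS !exprD !exprS; ring.
Qed.

(** The factor due to [k] vertices outside [A] in a set that contains [None] and meets [A]. It
    vanishes at [k = 0], where the minimum has another form. *)
Definition mixed_term (s k : nat) : {mpoly int[2]} :=
  if k is k'.+1 then varx ^+ k * vary ^+ minn (2 * k) (s + 1) else 0.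

(** If [B] misses [A], then [None] is isolated and only the singleton of [None] survives, giving the
    second summand. Otherwise a vertex of [A] is a hub, and the first or third summand applies
    according to whether [B] lies inside [A]. *)
Lemma da_term_with_None B :
  (if ((opt_set true B : {set H}) != set0) &&
     connected_graph (induced (opt_set true B : {set H}))
   then varx ^+ #|opt_set true B| * vary ^+ fy (opt_set true B : {set H}) else 0)
  = let i := #|B :&: A| in let j := #|B :\: A| in
    (varx * vary ^+ 2 * clique_term i) * (j == 0%N)%:R
    + (i == 0%N)%:R * ((varx * vary ^+ (#|~: A|).+1) * (j == 0%N)%:R)
    + (varx * vary * clique_term i) * mixed_term #|~: A| j.
Proof.
rewrite -cards_eq0 !card_opt_set add1n /=.
have cB := cardsID A B.
have [BA0|/set0Pn[w]] := eqVneq (B :&: A) set0.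
  have NA i : i \in B -> i \notin A.
    by move=> iB; have := in_set0 i; rewrite -BA0 inE iB => /= ->.
  have -> : B :\: A = B by rewrite -[LHS]set0U -BA0 setID.
  have [->|/set0Pn[u uB]] := eqVneq B set0.
    have -> : opt_set true (set0 : {set complete n}) = [set None].
      by apply/setP=> -[i|]; rewrite !inE.
    rewrite (connected_set1 (G := H)) fy_set1 codeg_None set0I cards0 /= expr1.
    by rewrite !(mulr0, mul0r, mulr1, mul1r, add0r, addr0).
  rewrite (@isolated_disconnected H _ None (Some u)) ?inE //; last first.
    by case=> [i|]; rewrite inE //=; exact: NA.
  rewrite BA0 cards0 (_ : (#|B| == 0%N) = false) /=; first by ring.
  by apply/negbTE; rewrite cards_eq0; apply/set0Pn; exists u.
rewrite inE => /andP[wB wA].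
have -> : connected_graph (induced (opt_set true B : {set H})).
  apply: (@connected_hub H _ (Some w)) => [|[v|]]; rewrite !inE //= => _.
  by rewrite (inj_eq Some_inj) eq_sym.
(* Vertices of [A] have value [2#|B| + 1], the others in [B] have [2#|B|], and [None] has
   [2#|B :&: A| + #|~: A| + 1]. The first is never below the second, so it matters only when [B]
   lies inside [A]. *)
pose m := if #|B :\: A| == 0%N then #|B|.*2.+1
          else minn #|B|.*2 (#|B :&: A|.*2 + #|~: A|.+1).
have le_v (v : H) : v \in opt_set true B ->
    (m <= alliance_val (opt_set true B : {set H}) v)%N.
  rewrite /m; case: v => [v|]; rewrite inE.
    move=> vB; rewrite alliance_val_Some //=; case: eqVneq => [/eqP|_].
      rewrite cards_eq0 => /eqP BA0.
      have: v \notin B :\: A by rewrite BA0 inE.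
      by rewrite inE vB andbT negbK => ->; lia.
    by apply: leq_trans (geq_minl _ _) _; case: (v \in A); lia.
  move=> _; rewrite alliance_val_None; case: eqVneq => [BA0|_]; last exact: geq_minr.
  lia.
have -> : fy (opt_set true B : {set H}) = m.
  have [BA0|/set0Pn[u]] := eqVneq (B :\: A) set0.
    apply: (@fy_min H _ (Some w)) le_v; first by rewrite inE.
    by rewrite alliance_val_Some // wA /m BA0 cards0 /=; lia.
  move=> uBA; have BA0 : #|B :\: A| != 0%N by rewrite cards_eq0; apply/set0Pn; exists u.
  move: uBA; rewrite inE => /andP[uA uB].
  have [le|lt] := leqP #|B|.*2 (#|B :&: A|.*2 + #|~: A|.+1).
    apply: (@fy_min H _ (Some u)) le_v; first by rewrite inE.
    by rewrite alliance_val_Some // uA (negbTE uA) /m (negbTE BA0) (minn_idPl le) /=; lia.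
  apply: (@fy_min H _ None) le_v; first by rewrite inE.
  by rewrite alliance_val_None /m (negbTE BA0) (minn_idPr (ltnW lt)).
have : (0 < #|B :&: A|)%N by apply/card_gt0P; exists w; rewrite inE wB.
rewrite /m -{}cB {le_v m}; case: #|B :&: A| #|B :\: A| => [|i] [|j] //= _.
  by rewrite !addn0 doubleS !exprS; ring.
(* Twice the size of [B :&: A] is common to both arguments of the minimum; taking it out leaves the
   exponent in [mixed_term]. *)
rewrite doubleD -addn_minr mul2n addn1; set M := minn _ _.
by rewrite [i.+1.*2]doubleS addSn !exprS !exprD !exprS; ring.
Qed.

(** Each summand of the two term formulas is a function of [#|B :&: A|] times a function of
    [#|B :\: A|], so each double sum factors by [binsumM]. *)
Lemma da_complete_plus :
  da H = binsum #|A| clique_term + vary * binsum #|~: A| clique_term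
    + vary * binsum #|A| clique_term * binsum #|~: A| clique_term
    + varx * vary ^+ 2 * binsum #|A| clique_term
    + varx * vary ^+ (#|~: A|).+1
    + varx * vary * binsum #|A| clique_term * binsum #|~: A| (mixed_term #|~: A|).
Proof.
rewrite /da big_mkcond sum_opt_set /=.
under eq_bigr => B _ do rewrite da_term_without_None da_term_with_None /=.
rewrite big_split /= !big_split /=.
pose e0 (j : nat) : {mpoly int[2]} := (j == 0%N)%:R.
rewrite (sum_card_setID A (fun i j => clique_term i * e0 j)).
rewrite (sum_card_setID A (fun i j => e0 i * (vary * clique_term j))).
rewrite (sum_card_setID A (fun i j => vary * clique_term i * clique_term j)).
rewrite (sum_card_setID A (fun i j => varx * vary ^+ 2 * clique_term i * e0 j)).
rewrite (sum_card_setID A (fun i j => e0 i * (varx * vary ^+ (#|~: A|).+1 * e0 j))).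
rewrite (sum_card_setID A (fun i j => varx * vary * clique_term i * mixed_term #|~: A| j)).
rewrite (binsumM _ _ clique_term e0) (binsumM _ _ e0 (fun j => vary * clique_term j)).
rewrite (binsumM _ _ (fun i => vary * clique_term i) clique_term).
rewrite (binsumM _ _ (fun i => varx * vary ^+ 2 * clique_term i) e0).
rewrite (binsumM _ _ e0 (fun j => varx * vary ^+ (#|~: A|).+1 * e0 j)).
rewrite (binsumM _ _ (fun i => varx * vary * clique_term i) (mixed_term _)).
rewrite !binsumZ !binsum_eq0; ring.
Qed.

End DaCompletePlus.

Theorem proposition41 (n : nat) (n_gt0 : (0 < n)%N) (A : {set complete n})
    (G : sgraph) :
  let H := complete_plus A in
  let v0 : H := None in
  let R : {set H} := [set u : H | adj v0 u] in
  let S : {set H} := ~: (v0 |: R) in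
  let r := #|R| in
  let s := #|S| in
  let x := varx in
  let y := vary in
  graph_iso G H <->
  da G = (1 + x * y ^+ 2) * da (complete r)
         + y * da (complete s)
         + y * da (complete r) * da (complete s)
         + x * y ^+ (n + 1 - r)
         + x * y * da (complete r)
           * (\sum_(1 <= j < s.+1)
                'C(s, j)%:R * x ^+ j * y ^+ minn (2 * j) (s + 1)).
Proof.
move=> H v0 R S r s x y.
have rE : r = #|A|.
  rewrite /r -[RHS](card_opt_set false); apply: eq_card.
  by case=> [i|]; rewrite !inE.
have sE : s = #|~: A|.
  rewrite /s -[RHS](card_opt_set false); apply: eq_card.
  by case=> [i|]; rewrite !inE.
have sumE : \sum_(1 <= j < s.+1) 'C(s, j)%:R * x ^+ j * y ^+ minn (2 * j) (s + 1)
    = binsum s (mixed_term s).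
  (* The extra index 0 contributes nothing because [mixed_term s 0] is 0. *)
  rewrite /binsum big_ord_recl mul0rn add0r big_add1 big_mkord.
  by apply: eq_bigr => j _; rewrite -[RHS]mulr_natl -mulrA.
have nE : (n + 1 - r = s.+1)%N.
  have := cardsC A; rewrite card_ord rE sE; lia.
(* The right-hand side equals [da H] whatever [G] is, so it remains to compare isomorphism with
   [da G = da H]. *)
set rhs := (X in _ <-> _ = X); have -> : rhs = da H.
  rewrite da_complete_plus /rhs sumE nE !da_complete -rE -sE /x /y !exprS; ring.
split=> [[f f_bij f_adj]|]; first by rewrite (da_iso f_bij f_adj).
exact: iso_of_da.
Qed.
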